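(* On tree metrics with $n\ge2$ servers and requests drawn i.i.d. uniformly from the server locations, algorithm FAIR-BIAS (defined below) is $4$-competitive: $\mathbb{E}[\mathrm{ALG}]\le 4\,\mathbb{E}[\mathrm{OPT}]$.
   Context: A tree metric is the shortest-path metric on the vertices of a finite tree with nonnegative edge lengths. Servers indexed by $S=[n]$ sit at vertices $s_1,\dots,s_n$ (not necessarily distinct); $d_{i,j}$ is the distance between $s_i$ and $s_j$. $n$ requests are drawn independently and uniformly from $S$ (request $j$ located at $s_j$), arriving online; each must be immediately matched to a currently free server at cost equal to their distance. $\mathrm{ALG}$ is the total cost, $\mathrm{OPT}$ the cost of an offline minimum-cost perfect matching of requests to servers. For $T\subseteq S$, $M(T)$ is the LP: minimize $\sum_{i\in T,j\in S}d_{i,j}x_{i,j}$ subject to $\sum_{j\in S}x_{i,j}=1/|T|$ for all $i\in T$, $\sum_{i\in T}x_{i,j}=1/n$ for all $j\in S$, $x\ge0$. Algorithm FAIR-BIAS: set $S_n=S$; for $k=n,\dots,1$: compute an optimal solution $x^{S_k}$ of $M(S_k)$; when request $r_k=r\in S$ arrives, choose $s\in S_k$ with probability $n\cdot x^{S_k}_{s,r}$, match $r$ to $s$, and set $S_{k-1}=S_k\setminus\{s\}$. *)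

(* Defs.v *)
From mathcomp Require Import all_boot all_order all_algebra all_fingroup.
From mathcomp Require Import classical_sets reals.

Set Implicit Arguments.
Unset Strict Implicit.
Unset Printing Implicit Defensive.

Import Order.TTheory GRing.Theory Num.Theory.
Local Open Scope ring_scope.

(* A cycle of the symmetric relation e that traverses an edge back and forth
   has size 2, so a graph cycle is a duplicate-free e-cycle of size >= 3. *)
Definition is_tree (V : finType) (e : rel V) : Prop :=
  [/\ symmetric e,
      irreflexive e,
      (forall u v : V, connect e u v) &
      (forall c : seq V, ucycle e c -> (size c <= 2)%N)].

Definition edge_lengths (R : realType) (V : finType) (e : rel V)
    (w : V -> V -> R) : Prop :=
  forall u v : V, e u v -> 0 <= w u v /\ w u v = w v u.

Definition walk_length (R : realType) (V : finType) (w : V -> V -> R)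
    (u : V) (p : seq V) : R :=
  \sum_(l <- pairmap w u p) l.

Definition path_dist (R : realType) (V : finType) (e : rel V)
    (w : V -> V -> R) (u v : V) : R :=
  inf [set l : R | exists p : seq V,
         [/\ path e u p, last u p = v & l = walk_length w u p]]%classic.

Definition server_dist (R : realType) (V : finType) (e : rel V)
    (w : V -> V -> R) (n : nat) (s : 'I_n -> V) (i j : 'I_n) : R :=
  path_dist e w (s i) (s j).

(* The variables of M(T) are the x i j with i \in T; the other rows of the
   matrix are unconstrained and never used. *)
Definition lp_feasible (R : realType) (n : nat) (T : {set 'I_n})
    (x : 'M[R]_n) : Prop :=
  [/\ (forall i, i \in T -> \sum_(j < n) x i j = #|T|%:R^-1),
      (forall j, \sum_(i in T) x i j = n%:R^-1) &
      (forall i j, i \in T -> 0 <= x i j)].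

Definition lp_cost (R : realType) (n : nat) (d : 'I_n -> 'I_n -> R)
    (T : {set 'I_n}) (x : 'M[R]_n) : R :=
  \sum_(i in T) \sum_(j < n) d i j * x i j.

Definition lp_optimal (R : realType) (n : nat) (d : 'I_n -> 'I_n -> R)
    (T : {set 'I_n}) (x : 'M[R]_n) : Prop :=
  lp_feasible T x /\
  forall y : 'M[R]_n, lp_feasible T y -> lp_cost d T x <= lp_cost d T y.

(* r t and sigma t are the t-th request to arrive and the server matched to it,
   t = 0, ..., n-1; hence the set S_k is free_servers sigma t for k = n - t. *)
Definition free_servers (n : nat) (sigma : {ffun 'I_n -> 'I_n}) (t : 'I_n)
  : {set 'I_n} :=
  ~: [set sigma u | u : 'I_n & (u < t)%N].

Definition match_cost (R : realType) (n : nat) (d : 'I_n -> 'I_n -> R)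
    (r : {ffun 'I_n -> 'I_n}) (sigma : 'I_n -> 'I_n) : R :=
  \sum_(t < n) d (sigma t) (r t).

Definition uniform_expectation (R : realType) (n : nat)
    (F : {ffun 'I_n -> 'I_n} -> R) : R :=
  \sum_(r : {ffun 'I_n -> 'I_n}) (\prod_(t < n) n%:R^-1) * F r.

(* The probability that FAIR-BIAS, run on the request sequence r with the LP
   solutions x, makes the successive choices sigma.  It is 0 as soon as sigma
   repeats a server. *)
Definition fair_bias_prob (R : realType) (n : nat) (x : {set 'I_n} -> 'M[R]_n)
    (r sigma : {ffun 'I_n -> 'I_n}) : R :=
  \prod_(t < n)
    (if sigma t \in free_servers sigma t
     then n%:R * x (free_servers sigma t) (sigma t) (r t) else 0).

Definition expected_ALG (R : realType) (n : nat) (d : 'I_n -> 'I_n -> R)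
    (x : {set 'I_n} -> 'M[R]_n) : R :=
  uniform_expectation (fun r =>
    \sum_(sigma : {ffun 'I_n -> 'I_n})
      fair_bias_prob x r sigma * match_cost d r sigma).

(* The default value of the minimum is the cost of the identity matching, which
   is itself in the range. *)
Definition OPT (R : realType) (n : nat) (d : 'I_n -> 'I_n -> R)
    (r : {ffun 'I_n -> 'I_n}) : R :=
  \big[Num.min/match_cost d r (1%g : 'S_n)]_(sigma : 'S_n) match_cost d r sigma.

Definition expected_OPT (R : realType) (n : nat) (d : 'I_n -> 'I_n -> R) : R :=
  uniform_expectation (OPT d).

(* Main.v *)
(** The request law enters FAIR-BIAS only through the marginal constraint of the
    linear program: averaging over a uniform request, every free server is
    chosen with probability [1/k].  The servers are therefore used up in a
    uniformly random order, the set [S_k] is a uniformly random [k]-subset, and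
    the [k]-th step costs on average the optimum of [M(S_k)].

    A tree metric is a nonnegative combination of cut metrics over a laminar
    family of vertex sets [A], which reduces the claim to one cut.  With
    [p = |A|/n], optimal transport to a laminar family costs [M(S_k)] at most
    [| |S_k & A|/k - p |] on the cut, and [OPT] pays at least [| N - n p |],
    where [N] counts the requests in [A].  Sampling without replacement has
    negative correlations, so the [k]-th step costs at most
    [sqrt (p (1 - p) / k)], for a total of at most [2 sqrt (n p (1 - p))], whereas
    the second and fourth moments of [N - n p] give
    [E |N - n p| >= sqrt (n p (1 - p)) / 2] as soon as [1 / n <= p <= 1 - 1 / n]. *)

Require Import Defs.
From mathcomp Require Import all_boot all_order all_algebra all_fingroup.
From mathcomp Require Import classical_sets reals.
From mathcomp Require Import ring lra zify.

Set Implicit Arguments.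
Unset Strict Implicit.
Unset Printing Implicit Defensive.

Import Order.TTheory GRing.Theory Num.Theory.
Local Open Scope ring_scope.

(** * Laminar cuts of a rooted tree *)

Section Dominators.
Variables (V : finType) (e : rel V) (root : V).

Definition avoid (v : V) : rel V := [rel x y | [&& e x y, x != v & y != v]].

(* [root] gets the whole of [V]; for [v != root], the vertex [v] lies in its own
   set, since no step of [avoid v] enters [v]. *)
Definition dominated (v : V) : {set V} :=
  [set u | (v == root) || ~~ connect (avoid v) root u].

Lemma path_avoid v x p :
  x != v -> path (avoid v) x p = path e x p && (v \notin p).
Proof.
elim: p x => [|y p IHp] x xv; rewrite ?andbT //= inE negb_or [v == y]eq_sym.
rewrite {1}/avoid /= xv.
by case: (eqVneq y v) => [->|yv] /=; rewrite ?andbF // andbT IHp // andbA.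
Qed.

Lemma dominatedPn v u :
  reflect (exists p, [/\ path e root p, last root p = u & v \notin root :: p])
          (u \notin dominated v).
Proof.
rewrite inE negb_or negbK; apply: (iffP andP) => [[vr /connectP[p]]|[p []]].
  rewrite path_avoid 1?eq_sym // => /andP[pp vp] ->.
  by exists p; rewrite inE negb_or vr.
move=> pp <-; rewrite inE negb_or => /andP[vr vp]; split=> //.
by apply/connectP; exists p => //; rewrite path_avoid 1?eq_sym // pp.
Qed.

Lemma dominated_refl v : v \in dominated v.
Proof.
apply/negPn/negP => /dominatedPn[p [_ <-]].
by rewrite mem_last.
Qed.

(** A walk from the root that misses [v'] also misses [v], since its part up to [v] would reach [v]
    without [v']. *)
Lemma dominated_trans v v' :
  v \in dominated v' -> dominated v \subset dominated v'.
Proof.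
move=> vv'; apply/fintype.subsetP => u; apply: contraLR => /dominatedPn[p [pp lp v'p]].
apply/dominatedPn; exists p; split=> //; apply: contraL vv' => vp.
case/splitPl: vp pp lp v'p => p1 p2 lp1; rewrite cat_path => /andP[pp1 _] _.
rewrite -cat_cons mem_cat negb_or => /andP[v'p1 _].
by apply/dominatedPn; exists p1.
Qed.

Lemma edge_dominated v x y :
  e x y -> x \notin dominated v -> y \in dominated v -> y = v.
Proof.
move=> exy /dominatedPn[p [pp lp vp]]; apply: contraTeq => yv.
apply/dominatedPn; exists (rcons p y).
by rewrite rcons_path pp lp exy last_rcons -rcons_cons mem_rcons inE negb_or eq_sym yv.
Qed.

Hypothesis e_conn : forall u v, connect e u v.

(** Both vertices lie on a simple path [p] from the root to [u]. If neither dominated the other, a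
    walk to [v] missing [v'] could replace the start of [p], so [v'] comes after [v] on [p]; by
    symmetry [v] comes after [v']. *)
Lemma dominated_total u v v' : u \in dominated v -> u \in dominated v' ->
  (v \in dominated v') || (v' \in dominated v).
Proof.
move=> uv uv'; rewrite -[_ || _]negbK negb_or; apply/negP => /andP[].
move=> /dominatedPn[P [pP lP v'P]] /dominatedPn[Q [pQ lQ vQ]].
have /connectP[p0 pp0 lp0] := e_conn root u.
case/shortenP: pp0 lp0 => p pp up _ lp.
have mem_p z : u \in dominated z -> z \in root :: p.
  by apply: contraTT => zp; apply/dominatedPn; exists p.
have detour z z' (Z : seq V) (p1 p2 : seq V) : u \in dominated z' ->
    p = p1 ++ p2 -> last root p1 = z -> path e root Z -> last root Z = z ->
    z' \notin root :: Z -> z' \notin p2 -> False.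
  move=> uz' pE lp1 pZ lZ z'Z z'p2; case/negP: uz'.
  apply/negP/dominatedPn; exists (Z ++ p2).
  have pp2 : path e z p2 by move: pp; rewrite pE cat_path lp1 => /andP[].
  have lp2 : last z p2 = u by rewrite lp pE last_cat lp1.
  by rewrite cat_path last_cat pZ lZ pp2 lp2 -cat_cons mem_cat negb_or z'Z.
have := mem_p _ uv; have := mem_p _ uv'.
move=> v'p vp; case/splitPl E: {1}p / vp => [p1 p2 lp1].
have [v'p2|/(detour v v' P p1 p2)] := boolP (v' \in p2); last by apply.
have v'p1 : v' \notin root :: p1.
  move: up; rewrite E -cat_cons cat_uniq => /and3P[_ /hasPn/(_ _ v'p2)].
  by [].
case/splitPl E2: {1}p / v'p => [q1 q2 lq1].
have [vq2|/(detour v' v Q q1 q2)] := boolP (v \in q2); last by apply.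
have vq1 : v \notin root :: q1.
  by move: up; rewrite E2 -cat_cons cat_uniq => /and3P[_ /hasPn/(_ _ vq2)].
have i1 : (index v (root :: p) < index v' (root :: p))%N.
  rewrite E -cat_cons !index_cat -{1}lp1 mem_last (negPf v'p1).
  by rewrite ltn_addr // -lp1 index_mem mem_last.
suff: (index v' (root :: p) < index v (root :: p))%N by rewrite ltnNge ltnW.
rewrite E2 -cat_cons !index_cat -{1}lq1 mem_last (negPf vq1).
by rewrite ltn_addr // -lq1 index_mem mem_last.
Qed.

Lemma dominated_laminar v v' :
  [|| dominated v \subset dominated v', dominated v' \subset dominated v
    | [disjoint dominated v & dominated v']].
Proof.
case: (boolP [disjoint _ & _]); rewrite ?orbT // => /pred0Pn[u /andP[uv uv']].
by case/orP: (dominated_total uv uv') => /dominated_trans -> //; rewrite orbT.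
Qed.

(** A simple path to [v'] passes through [v]; were the two distinct, its part up to [v] would miss
    [v']. *)
Lemma dominated_anti v v' :
  v \in dominated v' -> v' \in dominated v -> v = v'.
Proof.
move=> vv' v'v; apply/eqP; apply: contraTT vv' => nvv'.
have /connectP[p0 pp0 lp0] := e_conn root v'.
case/shortenP: pp0 lp0 => p pp up _ lp.
have vp : v \in root :: p.
  by apply: contraTT v'v => vp; apply/dominatedPn; exists p.
case/splitPl: vp pp up lp => p1 p2 lp1; rewrite cat_path => /andP[pp1 _].
rewrite -cat_cons cat_uniq last_cat lp1 => /and3P[_ dis _] lp2.
apply/dominatedPn; exists p1; split=> //; apply: contra dis => v'p1.
apply/hasP; exists v' => //; rewrite lp2.
by case: p2 lp2 => [/= v'E|x p2 _ /=]; [rewrite v'E eqxx in nvv' | exact: mem_last].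
Qed.

(** The default is reached only at the root, where [dominated root] is all of [V]; the root is its
    own parent. *)
Definition parent (v : V) : V :=
  odflt v [pick x | e x v && (x \notin dominated v)].

Lemma parentP v : v != root -> e (parent v) v /\ parent v \notin dominated v.
Proof.
move=> vr; rewrite /parent; case: pickP => [x /andP[]//|no_parent].
have /connectP[p0 pp0 lp0] := e_conn root v.
case/shortenP: pp0 lp0 => p pp up _.
case: (lastP p) pp up => [_ _ vE|q x]; first by rewrite vE eqxx in vr.
rewrite rcons_path last_rcons -rcons_cons rcons_uniq => /andP[pq eqx] /andP[xq _] vE.
have /andP[] := no_parent (last root q); split; rewrite vE //.
by apply/dominatedPn; exists q.
Qed.

Hypothesis e_sym : symmetric e.
Hypothesis e_acyclic : forall c : seq V, ucycle e c -> (size c <= 2)%N.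

(** Acyclicity enters here: two distinct such neighbours would be joined by a simple path avoiding
    [v], and closing it through [v] gives a cycle of at least three vertices. *)
Lemma parent_unique v x : e x v -> x \notin dominated v -> x = parent v.
Proof.
move=> exv xv.
have vr : v != root.
  by apply: contraNneq xv => ->; rewrite inE eqxx.
have [epv pv] := parentP vr.
have avoid_sym : connect_sym (avoid v).
  by apply: sym_connect_sym => y z; rewrite /avoid /= e_sym [(y != v) && _]andbC.
have conn z : z \notin dominated v -> connect (avoid v) root z.
  by rewrite inE negb_or negbK => /andP[].
have /connectP[p0 pp0 lp0] : connect (avoid v) x (parent v).
  by rewrite (connect_trans _ (conn _ pv)) // avoid_sym conn.
case/shortenP: pp0 lp0 => p pp up _ lp.
have xv' : x != v by apply: contraNneq xv => ->; apply: dominated_refl.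
move: pp; rewrite path_avoid // => /andP[pp vp].
have /e_acyclic : ucycle e [:: v, x & p].
  rewrite /ucycle cons_uniq up inE negb_or eq_sym xv' vp.
  by rewrite /= rcons_path pp -lp epv e_sym exv.
by case: p lp {pp up vp}.
Qed.

Lemma cut_edge v x y : e x y -> x \notin dominated v -> y \in dominated v ->
  x = parent v /\ y = v.
Proof.
move=> exy xv yv; have yE := edge_dominated exy xv yv; split=> //.
by apply: parent_unique; rewrite // -{1}yE.
Qed.

(** On a simple path to [v], the vertex before [v] is a neighbour outside [dominated v], hence the
    parent by uniqueness. *)
Lemma dominated_parent v : v != root -> v \in dominated (parent v).
Proof.
move=> vr; apply/negPn/negP => /dominatedPn[p0 [pp0 lp0 vp0]].
case/shortenP: pp0 (esym lp0) => p pp up sub.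
have {sub vp0} : parent v \notin root :: p.
  move: vp0; rewrite !inE !negb_or => /andP[-> /=]; apply: contra; exact: sub.
case: (lastP p) pp up => [_ _ _ vE|q x]; first by rewrite vE eqxx in vr.
rewrite rcons_path last_rcons -!rcons_cons rcons_uniq.
move=> /andP[pq eqx] /andP[xq _] + vE; subst x.
have <- : last root q = parent v.
  by apply: parent_unique => //; apply/dominatedPn; exists q.
by rewrite mem_rcons inE negb_or mem_last andbF.
Qed.

Lemma parent_cut_unique v v' : v' != root ->
  (v' \in dominated v) != (parent v' \in dominated v) -> v = v'.
Proof.
move=> v'r; have [ep pv'] := parentP v'r.
case: (boolP (v' \in dominated v)) => v'v; case: (boolP (parent v' \in _)) => pv // _.
  by have [_] := cut_edge ep pv v'v.
rewrite e_sym in ep; have [_ pE] := cut_edge ep v'v pv.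
by have := dominated_parent v'r; rewrite pE (negPf v'v).
Qed.

End Dominators.

(** * Weighted sums of cuts *)

Section CutDistance.
Variables (R : realType) (I V : finType) (c : I -> R) (A : I -> {set V}).

Definition cut_dist (x y : V) : R :=
  \sum_i c i * ((x \in A i) != (y \in A i))%:R.

Lemma cut_dist_sym x y : cut_dist x y = cut_dist y x.
Proof. by apply: eq_bigr => i _; rewrite eq_sym. Qed.

Lemma cut_distxx x : cut_dist x x = 0.
Proof. by apply: big1 => i _; rewrite eqxx mulr0. Qed.

Hypothesis c_ge0 : forall i, 0 <= c i.

Lemma cut_dist_triangle y x z : cut_dist x z <= cut_dist x y + cut_dist y z.
Proof.
rewrite /cut_dist -big_split /=; apply: ler_sum => i _.
rewrite -mulrDr ler_wpM2l // -natrD ler_nat.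
by case: (x \in _); case: (y \in _); case: (z \in _).
Qed.

End CutDistance.

(** * The tree metric as a sum of cuts *)

Section TreeMetric.
Variables (R : realType) (V : finType) (e : rel V) (w : V -> V -> R) (root : V).
Hypotheses (he : is_tree e) (hw : edge_lengths e w).

Notation dominated := (dominated e root).
Notation parent := (parent e root).

(** The cut of the root separates nothing; weight 0 keeps it nonnegative, as [w root root] is
    unconstrained. *)
Definition cut_weight (v : V) : R := if v == root then 0 else w (parent v) v.

Notation D := (cut_dist cut_weight dominated).

Let e_sym : symmetric e. Proof. by case: he. Qed.
Let e_conn u v : connect e u v. Proof. by case: he. Qed.
Let e_acyclic c : ucycle e c -> (size c <= 2)%N. Proof. by case: he => _ _ _; apply. Qed.

Lemma cut_weight_ge0 v : 0 <= cut_weight v.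
Proof.
rewrite /cut_weight; case: eqVneq => // vr.
by have [/hw[]] := parentP e_conn vr.
Qed.

(** Stepping from [x] to its parent crosses the cut of [x] and no other, and [y] is on the far side
    of that cut. *)
Lemma cut_dist_parent x y : y \notin dominated x ->
  D x y = w (parent x) x + D (parent x) y.
Proof.
move=> yx; have xr : x != root by apply: contraNneq yx => ->; rewrite inE eqxx.
have [_ px] := parentP e_conn xr.
rewrite /cut_dist (bigD1 x) //= [in RHS](bigD1 x) //= {1 2}/cut_weight (negPf xr).
rewrite dominated_refl (negPf yx) (negPf px) mulr1 mulr0 add0r; congr (_ + _).
apply: eq_bigr => v vx; congr (_ * (_ != _)%:R).
apply/eqP; apply: contraNT vx => /(parent_cut_unique e_conn e_sym e_acyclic xr).
by move=> ->.
Qed.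

Lemma cut_dist_edge x y : e x y -> D x y <= w x y.
Proof.
move=> exy; have [wxy wE] := hw exy.
have [|no_cut] := boolP [exists v, (v != root) && ((x \in dominated v) != (y \in dominated v))].
  case/existsP=> v /andP[vr sep].
  have [_ pv] := parentP e_conn vr.
  have D_pv : D v (parent v) = w (parent v) v by rewrite cut_dist_parent // cut_distxx addr0.
  move: sep; case: (boolP (x \in _)) => xv; case: (boolP (y \in _)) => yv //= _.
    rewrite e_sym in exy.
    have [-> ->] := cut_edge e_conn e_sym e_acyclic exy yv xv; rewrite D_pv.
    have [epv _] := parentP e_conn vr.
    by have [_ ->] := hw epv.
  have [-> ->] := cut_edge e_conn e_sym e_acyclic exy xv yv.
  by rewrite cut_dist_sym D_pv.
rewrite /cut_dist big1 // => v _; move: no_cut; rewrite negb_exists => /forallP/(_ v).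
rewrite /cut_weight; case: eqVneq => //= [_|_ /negbNE/eqP ->]; first by rewrite mul0r.
by rewrite eqxx mulr0.
Qed.

Lemma walk_length_cons u z p :
  walk_length w u (z :: p) = w u z + walk_length w z p.
Proof. by rewrite /walk_length /= big_cons. Qed.

Lemma walk_length_rcons u z p :
  walk_length w u (rcons p z) = walk_length w u p + w (last u p) z.
Proof. by rewrite /walk_length -cats1 pairmap_cat big_cat /= big_seq1. Qed.

Lemma cut_dist_walk u p : path e u p -> D u (last u p) <= walk_length w u p.
Proof.
elim: p u => [|z p IHp] u /=; first by rewrite cut_distxx /walk_length big_nil.
case/andP=> euz pp; rewrite walk_length_cons.
apply: le_trans (cut_dist_triangle _ cut_weight_ge0 z _ _) _.
by rewrite lerD ?IHp // cut_dist_edge.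
Qed.

(** Induction on the number of cuts separating the two ends. If [v] is not below [u], stepping from
    [u] to its parent removes one such cut; otherwise the step is taken at [v]. *)
Lemma cut_dist_attained u v :
  exists p, [/\ path e u p, last u p = v & walk_length w u p = D u v].
Proof.
pose cuts u v := [set x | (u \in dominated x) != (v \in dominated x)].
have cutsE x y z : (z \in cuts x y) = ((x \in dominated z) != (y \in dominated z)).
  by rewrite [LHS]finset.in_set.
have shrink x y : y \notin dominated x -> (#|cuts (parent x) y| < #|cuts x y|)%N.
  move=> yx; have xr : x != root by apply: contraNneq yx => ->; rewrite inE eqxx.
  have [_ px] := parentP e_conn xr.
  apply: proper_card; apply/properP; split.
    apply/fintype.subsetP => z; rewrite !cutsE.
    have [->|zx] := eqVneq z x; first by rewrite (negPf px) (negPf yx).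
    suff -> : (parent x \in dominated z) = (x \in dominated z) by [].
    apply/eqP; apply: contraNT zx; rewrite eq_sym.
    by move=> /(parent_cut_unique e_conn e_sym e_acyclic xr) ->.
  by exists x; rewrite cutsE ?dominated_refl (negPf yx) ?(negPf px).
have [m] := ubnP #|cuts u v|; elim: m u v => // m IHm u v; rewrite ltnS => cuts_m.
have [->|uv] := eqVneq u v.
  by exists [::]; rewrite cut_distxx /walk_length big_nil.
have [vu|vu] := boolP (v \in dominated u); last first.
  have ur : u != root by apply: contraNneq vu => ->; rewrite inE eqxx.
  have [epu _] := parentP e_conn ur; have [_ wE] := hw epu.
  have [p [pp lp lenp]] := IHm _ _ (leq_trans (shrink _ _ vu) cuts_m).
  exists (parent u :: p); rewrite /= e_sym epu pp; split=> //.
  by rewrite walk_length_cons lenp (cut_dist_parent vu) wE.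
have uv' : u \notin dominated v.
  by apply: contra uv => /(dominated_anti e_conn)/(_ vu) ->.
have vr : v != root by apply: contraNneq uv' => ->; rewrite inE eqxx.
have [epv _] := parentP e_conn vr.
have cutsC x y : #|cuts x y| = #|cuts y x|.
  by apply: eq_card => z; rewrite !cutsE eq_sym.
have [|p [pp lp lenp]] := IHm u (parent v).
  by rewrite cutsC (leq_trans (shrink _ _ uv')) // cutsC.
exists (rcons p v); rewrite rcons_path last_rcons pp lp; split=> //.
by rewrite walk_length_rcons lenp lp [RHS]cut_dist_sym (cut_dist_parent uv') addrC cut_dist_sym.
Qed.

Lemma path_distE u v : path_dist e w u v = D u v.
Proof.
have [p [pp lp lenp]] := cut_dist_attained u v.
rewrite /path_dist; set S := [set l | _]%classic.
have lbS : lbound S (D u v).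
  by move=> _ [q [pq <- ->]]; apply: cut_dist_walk.
apply/eqP; rewrite eq_le lb_le_inf //; last by exists (D u v); exists p.
by rewrite andbT; apply: ge_inf; [exists (D u v) | exists p].
Qed.

End TreeMetric.

(** * Transport for laminar cut metrics *)

Section Coupling.
Variables (R : realType) (I K : finType) (c : I -> R) (B : I -> {set K}).
Hypothesis c_ge0 : forall v, 0 <= c v.
Hypothesis B_laminar : forall v v',
  [|| B v \subset B v', B v' \subset B v | [disjoint B v & B v']].

(* The greedy step: in a smallest block [X] carrying both supply [mu] and
   demand [nu], a cut separating the chosen pair lies strictly inside [X], hence
   carries only supply or only demand, and shipping [delta] reduces its
   imbalance by exactly [delta]. *)
Lemma laminar_coupling (mu nu : K -> R) :
  (forall i, 0 <= mu i) -> (forall j, 0 <= nu j) ->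
  \sum_i mu i = \sum_j nu j ->
  exists pi : K -> K -> R, [/\ forall i j, 0 <= pi i j,
    forall i, \sum_j pi i j = mu i, forall j, \sum_i pi i j = nu j &
    \sum_i \sum_j cut_dist c B i j * pi i j <=
    \sum_v c v * `|\sum_(i in B v) mu i - \sum_(i in B v) nu i|].
Proof.
pose supp (f : K -> R) := [set i | f i != 0].
have [m] := ubnP (#|supp mu| + #|supp nu|)%N.
elim: m mu nu => // m IHm mu nu; rewrite ltnS => supp_m mu0 nu0 mass.
have [mu_z|[i0 mui0]] := set_0Vmem (supp mu).
  have muz i : mu i = 0.
    by apply/eqP; have /finset.setP/(_ i) := mu_z; rewrite !inE => /negbFE.
  have nuz j : nu j = 0.
    apply/eqP; move: mass; rewrite big1 // => /esym/eqP.
    by rewrite psumr_eq0 // => /allP/(_ j); rewrite mem_index_enum; apply.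
  exists (fun _ _ => 0); split=> [//|i|j|]; [by rewrite big1 | by rewrite big1 |].
  rewrite big1 => [|i _]; last by rewrite big1 // => j _; rewrite mulr0.
  by apply: sumr_ge0 => v _; rewrite mulr_ge0.
have [nu_z|[j0 nuj0]] := set_0Vmem (supp nu).
  have nuz j : nu j = 0.
    by apply/eqP; have /finset.setP/(_ j) := nu_z; rewrite !inE => /negbFE.
  move: mui0; rewrite inE => /negP[]; move: mass; rewrite [RHS]big1 // => /eqP.
  by rewrite psumr_eq0 // => /allP/(_ i0); rewrite mem_index_enum; apply.
(* [None] stands for the whole set, which carries both supply and demand, so a smallest mixed block
   exists. *)
pose block (o : option I) := if o is Some v then B v else finset.setT.
have block_laminar v o :
    [|| B v \subset block o, block o \subset B v | [disjoint B v & block o]].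
  by case: o => [v'|] /=; rewrite ?B_laminar // finset.subsetT.
pose mixed o := ~~ [disjoint block o & supp mu] && ~~ [disjoint block o & supp nu].
have mixed0 : mixed None.
  rewrite /mixed /=; apply/andP; split; apply/pred0Pn.
    by exists i0; rewrite /= finset.in_setT.
  by exists j0; rewrite /= finset.in_setT.
case: (arg_minnP (fun o => #|block o|) mixed0) => o /andP[].
move=> /pred0Pn[i /= /andP[iX imu]] /pred0Pn[j /= /andP[jX jnu]] min_o.
have smaller v : (B v \subset block o) -> ~~ (block o \subset B v) -> ~~ mixed (Some v).
  move=> sub nsub; apply/negP => /min_o /=; rewrite leqNgt proper_card //.
  by rewrite properE sub.
rewrite !inE in imu jnu.
(* Shipping this amount empties [i] or [j], so the total support size, on which the induction runs,
   drops. *)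
pose delta := Num.min (mu i) (nu j).
have delta0 : 0 <= delta by rewrite le_min mu0 nu0.
pose mu' k := mu k - delta * (k == i)%:R.
pose nu' k := nu k - delta * (k == j)%:R.
have mu'0 k : 0 <= mu' k.
  rewrite /mu'; case: eqP => [->|_]; rewrite ?mulr0 ?subr0 // mulr1 subr_ge0.
  by rewrite ge_min lexx.
have nu'0 k : 0 <= nu' k.
  rewrite /nu'; case: eqP => [->|_]; rewrite ?mulr0 ?subr0 // mulr1 subr_ge0.
  by rewrite ge_min lexx orbT.
have sum_delta (P : pred K) k : \sum_(l | P l) delta * (l == k)%:R = delta * (P k)%:R.
  rewrite -mulr_sumr; congr (_ * _); case: (boolP (P k)) => Pk.
    rewrite (bigD1 k) //= eqxx big1 ?addr0 // => l /andP[_ /negPf->] //.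
  by rewrite big1 // => l Pl; case: eqP Pk => // <-; rewrite Pl.
have mass' : \sum_k mu' k = \sum_k nu' k.
  by rewrite /mu' /nu' !sumrB mass !sum_delta.
have supp_mu' : supp mu' \subset supp mu.
  apply/fintype.subsetP => k; rewrite !inE; apply: contra => /eqP muk.
  have := mu'0 k; rewrite /mu' muk sub0r oppr_ge0 => le0.
  by rewrite oppr_eq0 eq_le le0 mulr_ge0.
have supp_nu' : supp nu' \subset supp nu.
  apply/fintype.subsetP => k; rewrite !inE; apply: contra => /eqP nuk.
  have := nu'0 k; rewrite /nu' nuk sub0r oppr_ge0 => le0.
  by rewrite oppr_eq0 eq_le le0 mulr_ge0.
have supp_lt : (#|supp mu'| + #|supp nu'| < m)%N.
  apply: leq_trans supp_m; case: (leP (mu i) (nu j)) => cmp.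
    rewrite -addSn leq_add ?subset_leq_card //; apply: proper_card.
    rewrite properE supp_mu'; apply/subsetPn; exists i; rewrite !inE //.
    by rewrite /mu' /delta min_l // eqxx mulr1 subrr eqxx.
  rewrite -addnS leq_add ?subset_leq_card //; apply: proper_card.
  rewrite properE supp_nu'; apply/subsetPn; exists j; rewrite !inE //.
  by rewrite /nu' /delta min_r 1?ltW // eqxx mulr1 subrr eqxx.
have [pi' [pi'0 pi'mu pi'nu cost']] := IHm _ _ supp_lt mu'0 nu'0 mass'.
exists (fun k l => pi' k l + delta * (k == i)%:R * (l == j)%:R); split.
- by move=> k l; rewrite addr_ge0 // !mulr_ge0.
- move=> k; rewrite big_split /= pi'mu -mulr_sumr.
  rewrite (bigD1 j) //= eqxx big1 => [|l /negPf->] //.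
  by rewrite addr0 mulr1 subrK.
- move=> l; rewrite big_split /= pi'nu -mulr_suml sum_delta mulr1.
  by rewrite subrK.
have -> : \sum_k \sum_l cut_dist c B k l * (pi' k l + delta * (k == i)%:R * (l == j)%:R)
    = \sum_k \sum_l cut_dist c B k l * pi' k l + cut_dist c B i j * delta.
  rewrite [X in _ + X](_ : _ =
    \sum_k \sum_l cut_dist c B k l * (delta * (k == i)%:R * (l == j)%:R)).
    rewrite -big_split; apply: eq_bigr => k _; rewrite -big_split.
    by apply: eq_bigr => l _; rewrite mulrDr.
  rewrite (bigD1 i) //= (bigD1 j) //= !eqxx !mulr1 !big1 ?addr0 //.
    by move=> k /negPf->; rewrite big1 // => l _; rewrite mulr0 mul0r mulr0.
  by move=> l /negPf->; rewrite !mulr0.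
apply: le_trans (lerD cost' (lexx _)) _.
rewrite /cut_dist mulr_suml -big_split /=; apply: ler_sum => v _.
rewrite -mulrA -mulrDr ler_wpM2l //.
rewrite /mu' /nu' !sumrB !sum_delta.
have sum_ge0 (f : K -> R) : (forall k, 0 <= f k) -> 0 <= \sum_(k in B v) f k.
  by move=> f0; apply: sumr_ge0.
case: (boolP (i \in B v)) => iv; case: (boolP (j \in B v)) => jv /=.
- by rewrite mul0r addr0 opprB addrA subrK.
(* [B v] is properly inside the chosen block and holds supply at [i], so minimality leaves it
   without demand. *)
- have sub : ~~ (block o \subset B v) by apply/subsetPn; exists j.
  have /or3P[sub'|sub'|/pred0P/(_ i)] := block_laminar v o; first last.
  + by rewrite /= iv iX.
  + by rewrite sub' in sub.
  have := smaller _ sub' sub; rewrite negb_and !negbK => /orP[] /pred0P dis.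
    by have := dis i; rewrite /= iv inE imu.
  rewrite [X in _ - (X - _)]big1 ?[X in _ <= `|_ - X|]big1; first last.
  + by move=> k kv; have := dis k; rewrite /= kv inE => /negbFE/eqP.
  + by move=> k kv; have := dis k; rewrite /= kv inE => /negbFE/eqP.
  rewrite mulr0 !subr0 mulr1 mul1r [X in _ <= X]ger0_norm ?sum_ge0 //.
  rewrite ger0_norm ?subrK // subr_ge0 (bigD1 i) //= ler_wpDr ?sumr_ge0 //.
  by rewrite ge_min lexx.
- have sub : ~~ (block o \subset B v) by apply/subsetPn; exists i.
  have /or3P[sub'|sub'|/pred0P/(_ j)] := block_laminar v o; first last.
  + by rewrite /= jv jX.
  + by rewrite sub' in sub.
  have := smaller _ sub' sub; rewrite negb_and !negbK => /orP[] /pred0P dis; last first.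
    by have := dis j; rewrite /= jv inE jnu.
  rewrite [X in `|X - _ - _|]big1 ?[X in _ <= `|X - _|]big1; first last.
  + by move=> k kv; have := dis k; rewrite /= kv inE => /negbFE/eqP.
  + by move=> k kv; have := dis k; rewrite /= kv inE => /negbFE/eqP.
  rewrite mulr0 subrr !sub0r !normrN mulr1 mul1r [X in _ <= X]ger0_norm ?sum_ge0 //.
  rewrite ger0_norm ?subrK // subr_ge0 (bigD1 j) //= ler_wpDr ?sumr_ge0 //.
  by rewrite ge_min lexx orbT.
- by rewrite mul0r addr0 mulr0 !subr0.
Qed.

End Coupling.

(** * The order in which FAIR-BIAS uses the servers *)

Section RandomOrder.
Variables (R : realType) (n : nat).

Notation free s t := (free_servers (val (s : 'S_n)) t).

Lemma sum_perm_tperm (F : 'S_n -> R) (t u : 'I_n) :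
  \sum_s F s = \sum_s F (tperm t u * s)%g.
Proof. by rewrite (reindex_inj (mulgI (tperm t u))). Qed.

Lemma val_permE (s : 'S_n) i : val s i = s i.
Proof. by rewrite -pvalE. Qed.

Lemma mem_free_servers (s : 'S_n) t i : (i \in free s t) = (t <= s^-1%g i)%N.
Proof.
rewrite finset.in_setC leqNgt; congr negb; apply/imsetP/idP => [[u ut ->]|lt].
  by rewrite inE in ut; rewrite val_permE permK.
by exists (s^-1%g i); rewrite ?inE // val_permE permKV.
Qed.

Lemma free_servers_tperm (s : 'S_n) (t u : 'I_n) :
  (t <= u)%N -> free (tperm t u * s)%g t = free s t.
Proof.
move=> tu; apply/finset.setP => i; rewrite !mem_free_servers invMg tpermV permM.
by case: tpermP => [->|->|]; rewrite ?tu ?leqnn.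
Qed.

Lemma card_ord_lt (t : 'I_n) : #|[set u : 'I_n | (u < t)%N]| = t.
Proof.
rewrite -[RHS]card_ord -!sum1_card (big_ord_widen n (fun _ => 1%N)) 1?ltnW //.
by apply: eq_bigl => u; rewrite inE.
Qed.

Lemma card_free_servers (s : 'S_n) t : #|free s t| = (n - t)%N.
Proof.
rewrite cardsCs finset.setCK card_ord card_imset ?card_ord_lt // => u v.
by rewrite !val_permE => /perm_inj.
Qed.

Lemma sum_free_servers (s : 'S_n) t (F : 'I_n -> R) :
  \sum_(i in free s t) F i = \sum_(u < n | (t <= u)%N) F (s u).
Proof.
rewrite (reindex_inj (@perm_inj _ s)); apply: eq_bigl => u.
by rewrite mem_free_servers permK.
Qed.

Lemma sum_ord_geq_const (t : 'I_n) (a : R) :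
  \sum_(u < n | (t <= u)%N) a = (n - t)%:R * a.
Proof.
rewrite sumr_const mulr_natl -(card_free_servers 1%g t); congr (_ *+ _).
by apply: eq_card => u; rewrite mem_free_servers invg1 perm1.
Qed.

(** Given the free set at time [t], the next pick is uniform on it: each free server is the pick at
    some time [u] not before [t], and swapping [t] and [u] leaves the free set unchanged. *)
Lemma sum_perm_free_servers (F : {set 'I_n} -> 'I_n -> R) (t : 'I_n) :
  \sum_s \sum_(i in free s t) F (free s t) i =
  (n - t)%:R * \sum_(s : 'S_n) F (free s t) (s t).
Proof.
under eq_bigr => s _ do rewrite sum_free_servers.
rewrite exchange_big /= (eq_bigr (fun _ => \sum_(s : 'S_n) F (free s t) (s t))).
  exact: sum_ord_geq_const.
move=> u tu; rewrite (sum_perm_tperm _ t u); apply: eq_bigr => s _.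
by rewrite free_servers_tperm // permM tpermR.
Qed.

Lemma sum_injective_ffun (F : {ffun 'I_n -> 'I_n} -> R) :
  \sum_(f : {ffun _} | injectiveb f) F f = \sum_(s : 'S_n) F (val s).
Proof.
rewrite (reindex_onto (val : 'S_n -> _) (insubd (1%g : 'S_n))) => [|f injf].
  by apply: eq_bigl => s; rewrite valKd eqxx andbT; apply: (valP s).
exact: insubdK.
Qed.

End RandomOrder.

(** * The expected cost of FAIR-BIAS *)

Section ExpectedCost.
Variables (R : realType) (n : nat) (d : 'I_n -> 'I_n -> R).
Variable (x : {set 'I_n} -> 'M[R]_n).
Hypothesis n_gt0 : (0 < n)%N.
Hypothesis x_feasible : forall T, T != finset.set0 -> lp_feasible T (x T).

Notation free s t := (free_servers (val (s : 'S_n)) t).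

(** Once [sigma] and the charged step [t0] are fixed, the free sets do not depend on the requests,
    so the mean over independent requests factors over time; the factor [n] cancels the request
    probability. *)
Lemma expected_ALG_prod : expected_ALG d x =
  \sum_(sigma : {ffun 'I_n -> 'I_n}) \sum_t0 \prod_t \sum_j
    (if sigma t \in free_servers sigma t
     then x (free_servers sigma t) (sigma t) j else 0) *
    (if t == t0 then d (sigma t) j else 1).
Proof.
have n_neq0 : n%:R != 0 :> R by rewrite pnatr_eq0 -lt0n.
rewrite /expected_ALG /uniform_expectation.
under eq_bigr => r _ do rewrite mulr_sumr.
rewrite exchange_big /=; apply: eq_bigr => sigma _.
under eq_bigr => r _ do rewrite /match_cost mulrA mulr_sumr.
rewrite exchange_big /=; apply: eq_bigr => t0 _.
rewrite bigA_distr_bigA /=; apply: eq_bigr => r _.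
rewrite -big_split -[d _ _](big_pred1_eq *%R t0 (fun t => d (sigma t) (r t))).
rewrite [X in _ * X]big_mkcond -big_split; apply: eq_bigr => t _ /=.
by congr (_ * _); case: ifP; rewrite ?mulr0 // mulKf.
Qed.

(** Summing out the request at a step that is not charged leaves a row sum [1/(n - t)] of the linear
    program, so the servers are used in uniformly random order. *)
Lemma expected_ALG_perm : expected_ALG d x =
  n`!%:R^-1 * \sum_(s : 'S_n) \sum_t lp_cost d (free s t) (x (free s t)).
Proof.
rewrite expected_ALG_prod (bigID (fun f : {ffun _} => injectiveb f)) /=.
rewrite addrC big1 ?add0r; last first.
  move=> sigma /injectivePn[u [v uv suv]]; apply: big1 => t0 _.
  (* The repeated server is no longer free at the later time [v], so the factor there vanishes. *)
  wlog ltuv : u v uv suv / (u < v)%N.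
    move=> wl; move: (uv); rewrite neq_ltn => /orP[|vu]; first exact: wl.
    by apply: (wl v u); rewrite // eq_sym.
  rewrite (bigD1 v) //= big1 ?mul0r // => j _; case: ifP => [|_]; last by rewrite mul0r.
  by rewrite finset.in_setC => /imsetP[]; exists u; rewrite ?inE.
rewrite sum_injective_ffun exchange_big [in RHS]exchange_big mulr_sumr.
apply: eq_bigr => t0 _ /=.
(* The factor [n - t0] gained here cancels the [t0] factor of [1/n!], leaving the product of
   [1/(n - t)] over the other steps. *)
rewrite (sum_perm_free_servers (fun T i => \sum_j d i j * x T i j)) mulrA mulr_sumr.
apply: eq_bigr => s _.
have free_t t : s t \in free s t by rewrite mem_free_servers permK.
under eq_bigr => t _ do rewrite val_permE free_t.
rewrite (bigD1 t0) //= eqxx mulrC; congr (_ * _); last first.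
  by apply: eq_bigr => j _; rewrite mulrC.
have n_t0 : (n - t0)%:R != 0 :> R by rewrite pnatr_eq0 -lt0n subn_gt0.
rewrite -ffactnn ffact_prod natr_prod -prodfV [in RHS](bigD1 t0) //= mulrAC mulVf ?mul1r //.
apply: eq_bigr => t tt0; rewrite (negPf tt0) -(card_free_servers s).
have [|row_sum _ _] := x_feasible (T := free s t).
  by apply/finset.set0Pn; exists (s t).
by rewrite -(row_sum _ (free_t t)); apply: eq_bigr => j _; rewrite mulr1.
Qed.

End ExpectedCost.

(** * Sampling with and without replacement *)

Section Sampling.
Variables (R : realType) (n : nat) (y : 'I_n -> R).
Hypothesis n_gt0 : (0 < n)%N.
Hypothesis y_mean0 : \sum_i y i = 0.

Notation free s t := (free_servers (val (s : 'S_n)) t).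

Definition moment (j : nat) : R := n%:R^-1 * \sum_i y i ^+ j.

Let n_neq0 : n%:R != 0 :> R. Proof. by rewrite pnatr_eq0 -lt0n. Qed.

Let fact_neq0 : n`!%:R != 0 :> R. Proof. by rewrite pnatr_eq0 -lt0n fact_gt0. Qed.

Lemma sum_perm_eval (f : 'I_n -> R) u :
  \sum_(s : 'S_n) f (s u) = n`!%:R * (n%:R^-1 * \sum_i f i).
Proof.
apply: (mulfI n_neq0); rewrite mulrCA mulVKf //.
transitivity (\sum_(v < n) \sum_(s : 'S_n) f (s v)).
  rewrite [RHS](eq_bigr (fun _ => \sum_(s : 'S_n) f (s u))) => [|v _].
    by rewrite sumr_const card_ord mulr_natl.
  by rewrite (sum_perm_tperm _ u v); apply: eq_bigr => s _; rewrite permM tpermR.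
rewrite exchange_big /= (eq_bigr (fun _ => \sum_i f i)) => [|s _].
  by rewrite sumr_const card_Sn mulr_natl.
by rewrite [RHS](reindex_inj (@perm_inj _ s)).
Qed.

(** All positions other than [u] give the same sum [C]. Adding the squares from [u] itself yields 0
    because [y] has mean zero, so a positive multiple of [C] is minus a sum of squares. *)
Lemma sum_perm_cov_le0 u v : u != v -> \sum_(s : 'S_n) y (s u) * y (s v) <= 0.
Proof.
move=> uv; set C := \sum_s _.
have CE v' : v' != u -> \sum_(s : 'S_n) y (s u) * y (s v') = C.
  move=> uv'; rewrite (sum_perm_tperm _ v v'); apply: eq_bigr => s _.
  by rewrite !permM tpermR tpermD // eq_sym.
have sumC : C *+ #|[pred v' | v' != u]| + \sum_(s : 'S_n) y (s u) ^+ 2 = 0.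
  rewrite -sumr_const (eq_bigr (fun v' => \sum_(s : 'S_n) y (s u) * y (s v'))); last first.
    by move=> v' /CE ->.
  rewrite exchange_big -big_split big1 //= => s _.
  rewrite expr2 -mulr_sumr -mulrDr addrC.
  rewrite -(bigD1 u (F := fun v => y (s v)) (P := xpredT)) //.
  by rewrite -(reindex_inj (@perm_inj _ s) (F := y) (P := xpredT)) y_mean0 mulr0.
have /lt0n_neq0 : (0 < #|[pred v' | v' != u]|)%N.
  by apply/card_gt0P; exists v; rewrite inE eq_sym.
rewrite leNgt; apply: contraNN => C0.
have sq_ge0 : 0 <= \sum_(s : 'S_n) y (s u) ^+ 2.
  by apply: sumr_ge0 => s _; apply: sqr_ge0.
move/eqP: sumC; rewrite paddr_eq0 ?mulrn_wge0 ?(ltW C0) //.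
by rewrite mulrn_eq0 (gt_eqF C0) orbF => /andP[].
Qed.

Lemma free_servers_moment2 (t : 'I_n) :
  n`!%:R^-1 * \sum_(s : 'S_n) (\sum_(i in free s t) y i) ^+ 2
  <= (n - t)%:R * moment 2.
Proof.
rewrite ler_pdivrMl ?ltr0n ?fact_gt0 //.
under eq_bigr => s _ do rewrite sum_free_servers expr2 mulr_suml.
rewrite exchange_big /=.
apply: (@le_trans _ _ (\sum_(u < n | (t <= u)%N) \sum_(s : 'S_n) y (s u) ^+ 2)).
  apply: ler_sum => u tu; under eq_bigr => s _ do rewrite mulr_sumr.
  rewrite exchange_big /= (bigD1 u) //= gerDl; apply: sumr_le0 => v /andP[_ vu].
  by rewrite sum_perm_cov_le0 // eq_sym.
under eq_bigr => u _ do rewrite (sum_perm_eval (fun i => y i ^+ 2)).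
by rewrite sum_ord_geq_const mulrCA lexx.
Qed.

Lemma free_servers_abs_moment (t : 'I_n) : 0 < moment 2 ->
  n`!%:R^-1 * \sum_(s : 'S_n) `|\sum_(i in free s t) y i|
  <= Num.sqrt ((n - t)%:R * moment 2).
Proof.
move=> V0; set tau := Num.sqrt _.
have kV0 : 0 < (n - t)%:R * moment 2 by rewrite mulr_gt0 // ltr0n subn_gt0.
have tau0 : 0 < tau by rewrite sqrtr_gt0.
have tau2 : tau ^+ 2 = (n - t)%:R * moment 2 by rewrite sqr_sqrtr // ltW.
(* AM-GM takes the place of Cauchy-Schwarz; with [tau] the bound on the root mean square, each half
   contributes at most [tau / 2]. *)
have amgm h : `|h| <= (2 * tau)^-1 * h ^+ 2 + tau / 2.
  have : 0 <= (2 * tau)^-1 * (`|h| - tau) ^+ 2.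
    by rewrite mulr_ge0 ?sqr_ge0 // invr_ge0 mulr_ge0 // ltW.
  rewrite -(real_normK (num_real h)).
  suff -> : (2 * tau)^-1 * (`|h| - tau) ^+ 2 = (2 * tau)^-1 * `|h| ^+ 2 + tau / 2 - `|h|.
    by rewrite subr_ge0.
  by field; rewrite gt_eqF.
apply: (@le_trans _ _ (n`!%:R^-1 * \sum_(s : 'S_n)
    ((2 * tau)^-1 * (\sum_(i in free s t) y i) ^+ 2 + tau / 2))).
  by rewrite ler_pM2l ?invr_gt0 ?ltr0n ?fact_gt0 //; apply: ler_sum => s _.
rewrite big_split -mulr_sumr /= mulrDr mulrCA sumr_const card_Sn.
rewrite -[(tau / 2) *+ _]mulr_natl mulKf //.
have := ler_wpM2l (ltW (_ : 0 < (2 * tau)^-1)) (free_servers_moment2 t).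
rewrite -tau2 invr_gt0 mulr_gt0 // => /(_ isT).
have -> : (2 * tau)^-1 * tau ^+ 2 = tau / 2 by field; rewrite gt_eqF.
lra.
Qed.

Lemma sum_inv_sqrt (m : nat) :
  \sum_(t < m) (Num.sqrt (m - t)%:R)^-1 <= 2 * Num.sqrt m%:R :> R.
Proof.
rewrite (reindex_inj rev_ord_inj) /=.
rewrite (eq_bigr (fun t : 'I_m => (Num.sqrt t.+1%:R)^-1)) => [|t _]; last first.
  by rewrite subKn.
elim: m => [|m IHm]; first by rewrite big_ord0 sqrtr0 mulr0.
rewrite big_ord_recr /=; apply: le_trans (lerD IHm (lexx _)) _.
have b0 : 0 < Num.sqrt m.+1%:R :> R by rewrite sqrtr_gt0.
have a0 : 0 <= Num.sqrt m%:R :> R by rewrite sqrtr_ge0.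
have a2 : Num.sqrt m%:R ^+ 2 = m%:R :> R by rewrite sqr_sqrtr.
have b2 : Num.sqrt m.+1%:R ^+ 2 = m%:R + 1 :> R by rewrite sqr_sqrtr // natr1.
move: (Num.sqrt _) (Num.sqrt _) a0 b0 a2 b2 => a b a0 b0 a2 b2.
(* Multiplied by [b], and with [b^2 = a^2 + 1], the claim becomes [2 a b + 1 <= 2 b^2], that is
   [(a - b)^2 >= 0]. *)
rewrite -(ler_pM2r b0) mulrDl mulVf ?gt_eqF //.
have := sqr_ge0 (a - b); nra.
Qed.

Lemma random_order_deviation : 0 < moment 2 ->
  n`!%:R^-1 * \sum_(s : 'S_n) \sum_(t < n) (n - t)%:R^-1 * `|\sum_(i in free s t) y i|
  <= 2 * Num.sqrt (n%:R * moment 2).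
Proof.
move=> V0; rewrite exchange_big mulr_sumr /=.
apply: (@le_trans _ _
  (\sum_(t < n) (Num.sqrt (n - t)%:R)^-1 * Num.sqrt (moment 2))).
  apply: ler_sum => t _; rewrite -mulr_sumr mulrCA.
  have k0 : 0 < (n - t)%:R :> R by rewrite ltr0n subn_gt0.
  rewrite ler_pdivrMl //; apply: le_trans (free_servers_abs_moment t V0) _.
  rewrite sqrtrM ?(ltW k0) // mulrA ler_pM2r ?sqrtr_gt0 //.
  rewrite -{2}[(n - t)%:R]sqr_sqrtr ?(ltW k0) // expr2 mulfK ?lexx //.
  by rewrite gt_eqF ?sqrtr_gt0.
rewrite -mulr_suml [Num.sqrt (n%:R * _)]sqrtrM // mulrA ler_pM2r ?sqrtr_gt0 //.
exact: sum_inv_sqrt.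
Qed.

(** * Moments of sums of independent draws *)

Definition iid_mean (m : nat) (F : {ffun 'I_m -> 'I_n} -> R) : R :=
  \sum_(r : {ffun 'I_m -> 'I_n}) n%:R^-1 ^+ m * F r.

Definition ffun_cons (m : nat) (k : 'I_n) (r : {ffun 'I_m -> 'I_n}) :
  {ffun 'I_m.+1 -> 'I_n} := [ffun i => oapp r k (unlift ord0 i)].

Lemma iid_mean_recl m (F : {ffun 'I_m.+1 -> 'I_n} -> R) :
  iid_mean F = n%:R^-1 * \sum_k iid_mean (fun r : {ffun 'I_m -> 'I_n} => F (ffun_cons k r)).
Proof.
rewrite /iid_mean pair_bigA mulr_sumr /=.
rewrite (reindex (fun p : 'I_n * {ffun 'I_m -> 'I_n} => ffun_cons p.1 p.2)) /=.
  by apply: eq_bigr => p _; rewrite mulrA exprS.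
exists (fun r : {ffun 'I_m.+1 -> 'I_n} => (r ord0, [ffun i => r (lift ord0 i)])).
  move=> [k r] _ /=; rewrite ffunE unlift_none; congr (_, _).
  by apply/ffunP => i; rewrite !ffunE liftK.
move=> r _; apply/ffunP => i; rewrite ffunE /=.
by case: unliftP => [j ->|->] //=; rewrite ffunE.
Qed.

Lemma iid_meanZ m (a : R) (F : {ffun 'I_m -> 'I_n} -> R) :
  iid_mean (fun r => a * F r) = a * iid_mean F.
Proof. by rewrite /iid_mean mulr_sumr; apply: eq_bigr => r _; rewrite mulrCA. Qed.

Lemma iid_meanD m (F G : {ffun 'I_m -> 'I_n} -> R) :
  iid_mean (fun r => F r + G r) = iid_mean F + iid_mean G.
Proof. by rewrite /iid_mean -big_split; apply: eq_bigr => r _; rewrite mulrDr. Qed.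

Lemma ler_iid_mean m (F G : {ffun 'I_m -> 'I_n} -> R) :
  (forall r, F r <= G r) -> iid_mean F <= iid_mean G.
Proof.
move=> FG; apply: ler_sum => r _; rewrite ler_wpM2l //.
by rewrite exprn_ge0 // invr_ge0.
Qed.

(** The number [m] of draws is kept apart from the population size [n], so that the moments can be
    computed by induction on [m]. *)
Definition iid_moment (m j : nat) : R :=
  iid_mean (fun r : {ffun 'I_m -> 'I_n} => (\sum_t y (r t)) ^+ j).

Lemma iid_moment_recl m j :
  iid_moment m.+1 j =
  \sum_(i < j.+1) 'C(j, i)%:R * (moment (j - i) * iid_moment m i).
Proof.
rewrite /iid_moment iid_mean_recl.
rewrite (eq_bigr (fun k => \sum_(i < j.+1)
  'C(j, i)%:R * (y k ^+ (j - i) * iid_moment m i))) => [|k _]; last first.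
  under eq_bigr => i _ do rewrite mulrA -iid_meanZ.
  rewrite /iid_mean exchange_big; apply: eq_bigr => r _ /=.
  rewrite -mulr_sumr; congr (_ * _).
  rewrite big_ord_recl ffunE unlift_none /=.
  under eq_bigr => t _ do rewrite ffunE liftK /=.
  by rewrite exprDn; apply: eq_bigr => i _; rewrite -mulr_natl mulrA.
rewrite exchange_big mulr_sumr; apply: eq_bigr => i _ /=.
by rewrite -mulr_sumr -mulr_suml mulrCA [n%:R^-1 * _]mulrA.
Qed.

Lemma moment0 : moment 0 = 1.
Proof.
rewrite /moment (eq_bigr (fun _ => 1)) => [|i _]; last by rewrite expr0.
by rewrite sumr_const card_ord mulVf.
Qed.

Lemma moment1 : moment 1 = 0.
Proof.
by rewrite /moment; under eq_bigr => i _ do rewrite expr1; rewrite y_mean0 mulr0.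
Qed.

Lemma iid_moment_base j : iid_moment 0 j = (j == 0%N)%:R.
Proof.
rewrite /iid_moment /iid_mean (eq_bigr (fun _ => (j == 0%N)%:R)) => [|r _].
  by rewrite sumr_const card_ffun !card_ord expn0 mulr1n.
by rewrite big_ord0 expr0 mul1r expr0n.
Qed.

Lemma iid_moment0 m : iid_moment m 0 = 1.
Proof.
elim: m => [|m IHm]; first by rewrite iid_moment_base.
by rewrite iid_moment_recl big_ord1 IHm moment0 !mulr1.
Qed.

Lemma iid_moment1 m : iid_moment m 1 = 0.
Proof.
elim: m => [|m IHm]; first by rewrite iid_moment_base.
rewrite iid_moment_recl !big_ord_recl big_ord0 /= /bump /= IHm.
by rewrite moment1 mul0r !mulr0 !addr0.
Qed.

Lemma iid_moment2 m : iid_moment m 2 = m%:R * moment 2.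
Proof.
elim: m => [|m IHm]; first by rewrite iid_moment_base mul0r.
rewrite iid_moment_recl !big_ord_recl big_ord0 /= /bump /= !subnn.
rewrite iid_moment0 iid_moment1 IHm moment0 -natr1 (_ : 'C(2, 0) = 1%N) //.
by rewrite (_ : 'C(2, 2) = 1%N) //; ring.
Qed.

(** In the recursion the third moment of the shorter sum is multiplied by [moment 1 = 0]; the
    increments [6 m] add up to [3 m (m - 1)]. *)
Lemma iid_moment4 m : iid_moment m 4 =
  m%:R * moment 4 + 3 * m%:R * (m%:R - 1) * moment 2 ^+ 2.
Proof.
elim: m => [|m IHm]; first by rewrite iid_moment_base mulr0 !mul0r addr0.
rewrite iid_moment_recl !big_ord_recl big_ord0 /= /bump /= !subnn.
rewrite iid_moment0 iid_moment1 iid_moment2 IHm moment0 moment1.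
rewrite (_ : 'C(4, 0) = 1%N) // (_ : 'C(4, 1 + 1) = 6%N) // (_ : 'C(4, 4) = 1%N) //.
by ring.
Qed.

(* [z >= 3/4 z^2 - z^4/16] for [z = |x| / sigma], i.e. [(z - 2)^2 (z + 4) >= 0],
   trades the first absolute moment for the second and fourth ones. *)
Lemma iid_abs_moment_ge m (sigma : R) : 0 < sigma ->
  iid_moment m 2 = sigma ^+ 2 -> iid_moment m 4 <= 4 * sigma ^+ 4 ->
  sigma / 2 <= iid_mean (fun r : {ffun 'I_m -> 'I_n} => `|\sum_t y (r t)|).
Proof.
move=> s0 m2 m4; have sN0 : sigma != 0 by rewrite gt_eqF.
have pointwise h : 3 / (4 * sigma) * h ^+ 2 + - (16 * sigma ^+ 3)^-1 * h ^+ 4 <= `|h|.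
  have -> : h ^+ 4 = (h ^+ 2) ^+ 2 by ring.
  rewrite -(real_normK (num_real h)); have := normr_ge0 h; move: `|h| => z z0.
  rewrite -subr_ge0.
  have -> : z - (3 / (4 * sigma) * z ^+ 2 + - (16 * sigma ^+ 3)^-1 * (z ^+ 2) ^+ 2)
      = (16 * sigma ^+ 3)^-1 * (z * ((z - 2 * sigma) ^+ 2 * (z + 4 * sigma))).
    by field.
  have c0 : 0 <= (16 * sigma ^+ 3)^-1 by rewrite invr_ge0 mulr_ge0 // exprn_ge0 // ltW.
  by rewrite mulr_ge0 // mulr_ge0 // mulr_ge0 ?sqr_ge0 // addr_ge0 // mulr_ge0 // ltW.
apply: le_trans (ler_iid_mean (fun r => pointwise _)).
rewrite iid_meanD !iid_meanZ -!/(iid_moment _ _) m2.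
(* The two moment hypotheses turn the terms into [3/4 sigma - 1/4 sigma]. *)
apply: (@le_trans _ _
  (3 / (4 * sigma) * sigma ^+ 2 - (16 * sigma ^+ 3)^-1 * (4 * sigma ^+ 4))).
  by rewrite le_eqVlt; apply/orP; left; apply/eqP; field.
rewrite lerD2l mulNr lerN2 ler_pM2l // invr_gt0 mulr_gt0 // exprn_gt0 //.
Qed.

End Sampling.

(** * Assembling the cuts *)

Section CutBound.
Variables (R : realType) (n : nat).
Hypothesis n_ge2 : (2 <= n)%N.

(** Shifted to mean zero, so that sums over free servers or along requests are deviations from the
    proportional share. *)
Definition centered (B : {set 'I_n}) (i : 'I_n) : R := (i \in B)%:R - #|B|%:R / n%:R.

Let n_gt0 : (0 < n)%N. Proof. exact: ltnW. Qed.
Let n_neq0 : n%:R != 0 :> R. Proof. by rewrite pnatr_eq0 -lt0n. Qed.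

Lemma sum_indicator (A B : {set 'I_n}) : \sum_(i in A) (i \in B)%:R = #|A :&: B|%:R :> R.
Proof.
rewrite -sum1_card natr_sum big_mkcond [RHS]big_mkcond; apply: eq_bigr => i _.
by rewrite finset.in_setI; case: (i \in A); case: (i \in B).
Qed.

Lemma sum_indicatorT (B : {set 'I_n}) : \sum_i (i \in B)%:R = #|B|%:R :> R.
Proof.
rewrite -[in RHS](finset.setTI B) -sum_indicator; apply: eq_bigl => i.
by rewrite finset.in_setT.
Qed.

Lemma sum_centered (B : {set 'I_n}) : \sum_i centered B i = 0.
Proof.
by rewrite sumrB sum_indicatorT sumr_const card_ord -[_ / _ *+ _]mulr_natr mulfVK // subrr.
Qed.

Lemma moment2_centered (B : {set 'I_n}) :
  moment (centered B) 2 = #|B|%:R * (n - #|B|)%:R / n%:R ^+ 2.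
Proof.
have Bn : (#|B| <= n)%N by rewrite -[leqRHS]card_ord max_card.
rewrite /moment (eq_bigr (fun i => (i \in B)%:R * (1 - 2 * (#|B|%:R / n%:R))
    + (#|B|%:R / n%:R) ^+ 2)) => [|i _]; last first.
  by rewrite /centered; case: (i \in B) => /=; ring.
rewrite big_split -mulr_suml /= sum_indicatorT sumr_const card_ord -[_ ^+ 2 *+ n]mulr_natl natrB //.
by field.
Qed.

Lemma moment4_centered_le (B : {set 'I_n}) :
  moment (centered B) 4 <= moment (centered B) 2.
Proof.
rewrite ler_pM2l ?invr_gt0 ?ltr0n //; apply: ler_sum => i _.
have Bn : (#|B| <= n)%N by rewrite -[leqRHS]card_ord max_card.
have p0 : 0 <= #|B|%:R / n%:R :> R by rewrite divr_ge0.
have p1 : #|B|%:R / n%:R <= 1 :> R by rewrite ler_pdivrMr ?ltr0n // mul1r ler_nat.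
rewrite -[4%N]/(2 + 2)%N exprD ler_piMr ?sqr_ge0 // /centered.
by case: (i \in B) => /=; nra.
Qed.

(** Both sides are compared with [sigma = sqrt (n V)]: the left is at most [2 sigma], the mean on
    the right at least [sigma / 2]. *)
Lemma random_order_le_iid (B : {set 'I_n}) :
  n`!%:R^-1 * \sum_(s : 'S_n) \sum_(t < n)
    (n - t)%:R^-1 * `|\sum_(i in free_servers (val s) t) centered B i|
  <= 4 * iid_mean (fun r : {ffun 'I_n -> 'I_n} => `|\sum_t centered B (r t)|).
Proof.
have Bn : (#|B| <= n)%N by rewrite -[leqRHS]card_ord max_card.
have mean_ge0 :
    0 <= iid_mean (fun r : {ffun 'I_n -> 'I_n} => `|\sum_t centered B (r t)|).
  by apply: sumr_ge0 => r _; rewrite mulr_ge0 // exprn_ge0 // invr_ge0.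
pose V : R := moment (centered B) 2.
have VE : V = #|B|%:R * (n - #|B|)%:R / n%:R ^+ 2 by rewrite /V moment2_centered.
(* For the empty and the full set [centered B] is identically zero; otherwise the variance is
   positive. *)
have [trivial_cut|] := boolP ((#|B| == 0)%N || (#|B| == n)).
  have y0 i : centered B i = 0.
    case/orP: trivial_cut => /eqP cB; rewrite /centered cB.
      by rewrite (cards0_eq cB) finset.in_set0 mul0r subrr.
    have -> : B = finset.setT.
      by apply/eqP; rewrite eqEcard finset.subsetT cardsT card_ord cB leqnn.
    by rewrite finset.in_setT divff // subrr.
  rewrite big1 ?mulr0 ?mulr_ge0 // => s _; rewrite big1 // => t _.
  by rewrite big1 ?normr0 ?mulr0 // => i _.
rewrite negb_or -lt0n => /andP[B_gt0 B_neqn].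
have B_ltn : (#|B| < n)%N by rewrite ltn_neqAle B_neqn.
(* For [0 < a < n] one has [a (n - a) >= n - 1], and [(n + 3) (n - 1) >= n^2]. The constant 3 fits
   the fourth moment bound, since [n (n + 3) + 3 n (n - 1) = 4 n^2]. *)
have V_ge : 1 <= (n%:R + 3) * V.
  rewrite VE mulrA ler_pdivlMr ?exprn_gt0 ?ltr0n // mul1r.
  rewrite -natrX -[3]/(3%:R) -natrD -!natrM ler_nat.
  by move: B_gt0 B_ltn n_ge2; clear; move: #|B| => a; nia.
have V0 : 0 < V by rewrite VE divr_gt0 ?exprn_gt0 ?mulr_gt0 ?ltr0n ?subn_gt0.
apply: le_trans (random_order_deviation n_gt0 (sum_centered B) V0) _.
set sigma := Num.sqrt _.
have nV0 : 0 < n%:R * V by rewrite mulr_gt0 // ltr0n.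
have s0 : 0 < sigma by rewrite sqrtr_gt0.
have s2 : sigma ^+ 2 = n%:R * V by rewrite sqr_sqrtr // ltW.
have := @iid_abs_moment_ge R n (centered B) n sigma s0.
rewrite (iid_moment2 n_gt0 (sum_centered B)) (iid_moment4 n_gt0 (sum_centered B)).
rewrite -/V s2 => /(_ erefl) half.
suff /half : n%:R * moment (centered B) 4 + 3 * n%:R * (n%:R - 1) * V ^+ 2 <= 4 * sigma ^+ 4.
  lra.
rewrite (exprM sigma 2 2) s2.
have m4 := moment4_centered_le B; rewrite -/V in m4.
have m4' : moment (centered B) 4 <= (n%:R + 3) * V ^+ 2.
  by apply: le_trans m4 _; rewrite expr2 mulrA ler_peMl // ltW.
apply: (@le_trans _ _ (n%:R * ((n%:R + 3) * V ^+ 2) + 3 * n%:R * (n%:R - 1) * V ^+ 2)).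
  by rewrite lerD2r ler_wpM2l.
by rewrite le_eqVlt; apply/orP; left; apply/eqP; ring.
Qed.

End CutBound.

Section LaminarCutMetric.
Variables (R : realType) (n : nat) (I : finType).
Variables (c : I -> R) (B : I -> {set 'I_n}) (x : {set 'I_n} -> 'M[R]_n).
Hypothesis n_ge2 : (2 <= n)%N.
Hypothesis c_ge0 : forall v, 0 <= c v.
Hypothesis B_laminar : forall v v',
  [|| B v \subset B v', B v' \subset B v | [disjoint B v & B v']].

Notation d := (cut_dist c B).

Hypothesis x_optimal : forall T, T != finset.set0 -> lp_optimal d T (x T).

Let n_gt0 : (0 < n)%N. Proof. exact: ltnW. Qed.
Let n_neq0 : n%:R != 0 :> R. Proof. by rewrite pnatr_eq0 -lt0n. Qed.

(** The laminar coupling of mass [1/|T|] on each point of [T] with mass [1/n] everywhere is feasible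
    for the program. *)
Lemma lp_cost_le_cuts (T : {set 'I_n}) : T != finset.set0 ->
  lp_cost d T (x T) <=
  \sum_v c v * (#|T|%:R^-1 * `|\sum_(i in T) centered R (B v) i|).
Proof.
move=> T0; have [_ opt] := x_optimal T0.
have cT : #|T|%:R != 0 :> R by rewrite pnatr_eq0 cards_eq0.
pose mu (i : 'I_n) : R := (i \in T)%:R * #|T|%:R^-1.
pose nu (i : 'I_n) : R := n%:R^-1.
have mu0 i : 0 <= mu i by rewrite mulr_ge0 // invr_ge0.
have nu0 i : 0 <= nu i by rewrite invr_ge0.
have mass : \sum_i mu i = \sum_j nu j.
  by rewrite -mulr_suml sum_indicatorT mulfV // sumr_const card_ord -[RHS]mulr_natl mulfV.
have [pi [pi0 pi_mu pi_nu cost]] := laminar_coupling c_ge0 B_laminar mu0 nu0 mass.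
have pi_out i j : i \notin T -> pi i j = 0.
  move=> iT; apply/eqP; have := pi_mu i; rewrite /mu (negPf iT) mul0r => /eqP.
  by rewrite psumr_eq0 // => /allP/(_ j); rewrite mem_index_enum; apply.
have sum_in (f : 'I_n -> R) :
    (forall i, i \notin T -> f i = 0) -> \sum_(i in T) f i = \sum_i f i.
  by move=> f0; rewrite [RHS](bigID (mem T)) /= [X in _ + X]big1 ?addr0.
pose P : 'M[R]_n := \matrix_(i, j) pi i j.
have /opt/le_trans : lp_feasible T P.
  split=> [i iT|j|i j _]; last by rewrite mxE.
    by under eq_bigr => j _ do rewrite mxE; rewrite pi_mu /mu iT mul1r.
  under eq_bigr => i _ do rewrite mxE.
  by rewrite sum_in => [|i /pi_out].
apply; rewrite /lp_cost sum_in => [|i iT]; last first.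
  by apply: big1 => j _; rewrite mxE pi_out ?mulr0.
under eq_bigr => i _ do under eq_bigr => j _ do rewrite mxE.
apply: le_trans cost _; apply: ler_sum => v _; rewrite ler_wpM2l //.
rewrite -[X in X * `|_|]ger0_norm ?invr_ge0 // -normrM le_eqVlt; apply/orP; left.
rewrite -mulr_suml sumr_const sumrB !sum_indicator sumr_const finset.setIC.
rewrite -[_ / _ *+ _]mulr_natl -[n%:R^-1 *+ _]mulr_natl.
by apply/eqP; congr `|_|; field; rewrite n_neq0 cT.
Qed.

(** A perfect matching uses exactly [#|B v|] servers in [B v], so the excess or shortage of requests
    there must be carried across the cut. *)
Lemma match_cost_ge_cuts (r : {ffun 'I_n -> 'I_n}) (s : 'S_n) :
  \sum_v c v * `|\sum_t centered R (B v) (r t)| <= match_cost d r s.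
Proof.
rewrite /match_cost /cut_dist exchange_big /=; apply: ler_sum => v _.
rewrite -mulr_sumr ler_wpM2l //.
have -> : \sum_t centered R (B v) (r t) =
    \sum_t ((r t \in B v)%:R - (s t \in B v)%:R).
  rewrite !sumrB -(reindex_inj (@perm_inj _ s) (P := xpredT) (F := fun i => (i \in B v)%:R)).
  by rewrite sum_indicatorT sumr_const card_ord -[_ / _ *+ _]mulr_natr mulfVK.
apply: le_trans (ler_norm_sum _ _ _) _; apply: ler_sum => t _.
by case: (r t \in _); case: (s t \in _); rewrite /= ?subrr ?subr0 ?sub0r ?normrN ?normr0 ?normr1.
Qed.

Lemma expected_OPT_ge_cuts :
  \sum_v c v * iid_mean (fun r : {ffun 'I_n -> 'I_n} => `|\sum_t centered R (B v) (r t)|)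
  <= expected_OPT d.
Proof.
rewrite /expected_OPT /uniform_expectation /iid_mean.
under eq_bigr => v _ do rewrite mulr_sumr.
rewrite exchange_big /=; apply: ler_sum => r _.
rewrite prodr_const card_ord.
under eq_bigr => v _ do rewrite mulrCA.
rewrite -mulr_sumr ler_wpM2l ?exprn_ge0 ?invr_ge0 // /OPT.
apply: (big_ind (fun z => _ <= z)) => [|a b la lb|s _]; rewrite ?match_cost_ge_cuts //.
by rewrite le_min la.
Qed.

Lemma expected_ALG_le_cuts :
  expected_ALG d x <= \sum_v c v * (n`!%:R^-1 * \sum_(s : 'S_n) \sum_(t < n)
    (n - t)%:R^-1 * `|\sum_(i in free_servers (val s) t) centered R (B v) i|).
Proof.
rewrite expected_ALG_perm // => [|T /x_optimal[]//].
under [leRHS]eq_bigr => v _ do rewrite mulrCA mulr_sumr.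
rewrite -mulr_sumr ler_pM2l ?invr_gt0 ?ltr0n ?fact_gt0 //.
rewrite [leRHS]exchange_big /=; apply: ler_sum => s _.
under [leRHS]eq_bigr => v _ do rewrite mulr_sumr.
rewrite [leRHS]exchange_big /=; apply: ler_sum => t _.
rewrite -(card_free_servers s); apply: lp_cost_le_cuts.
by rewrite -card_gt0 card_free_servers subn_gt0.
Qed.

Lemma fair_bias_laminar : expected_ALG d x <= 4%:R * expected_OPT d.
Proof.
apply: le_trans expected_ALG_le_cuts _.
apply: le_trans (ler_wpM2l _ expected_OPT_ge_cuts); rewrite // mulr_sumr.
by apply: ler_sum => v _; rewrite [leRHS]mulrCA ler_wpM2l // random_order_le_iid.
Qed.

End LaminarCutMetric.

Theorem theorem4 (R : realType) (V : finType) (e : rel V) (w : V -> V -> R)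
    (he : is_tree e) (hw : edge_lengths e w)
    (n : nat) (hn : (2 <= n)%N) (s : 'I_n -> V)
    (x : {set 'I_n} -> 'M[R]_n)
    (hx : forall T : {set 'I_n}, T != finset.set0 ->
       lp_optimal (server_dist e w s) T (x T)) :
  expected_ALG (server_dist e w s) x <= 4%:R * expected_OPT (server_dist e w s).
Proof.
have n_gt0 : (0 < n)%N by apply: ltnW.
(* Any vertex can serve as root; a server location is at hand because [n > 0]. *)
pose root := s (Ordinal n_gt0).
(* Pulling the cuts back to server indices preserves laminarity and allows servers to share a
   vertex. *)
pose B (v : V) := s @^-1: dominated e root v.
have inB v i : (i \in B v) = (s i \in dominated e root v) by rewrite [LHS]finset.in_set.
have dE : server_dist e w s = cut_dist (cut_weight e w root) B.
  apply/boolp.funext => i; apply/boolp.funext => j.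
  rewrite /server_dist (path_distE root he hw).
  by apply: eq_bigr => v _; rewrite !inB.
have [_ _ e_conn _] := he.
rewrite dE in hx *; apply: fair_bias_laminar => // [v|v v'].
  exact: cut_weight_ge0.
have /or3P[sub|sub|dis] := dominated_laminar root e_conn v v'.
- by rewrite preimsetS.
- by rewrite [X in _ || X]orbC orbA [_ || (B v' \subset _)]orbC preimsetS.
- apply/or3P/Or33/pred0P => i; have /pred0P/(_ (s i)) := dis.
  by rewrite /= !inB.
Qed.
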